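(* Let $B$ be a finite non-empty set of equivalence relations, let $b=\max\{|\rho|:\rho\in B\}$, and let $C=\mathrm{Av}(B)$ under the consecutive embedding order. Then $C$ is atomic if and only if the following hold: (i) for each $\sigma\in C$ with $1\le|\sigma|\le b-1$ there is $\rho\in C$ with $|\rho|=b$ such that $\sigma\le\rho$; and (ii) the factor graph $\Gamma_B$ is strongly connected or is a bicycle with no ambiguous vertices.
   Context: Equivalence relations and order. An equivalence relation here is a pair $(X,\rho)$ with $X$ a finite non-empty subset of $\mathbb{N}$ (with its natural linear order) and $\rho$ an equivalence relation on $X$; its length is $|\rho|=|X|$. For $X=\{x_1<\dots<x_n\}$ and $Y=\{y_1<\dots<y_m\}$, a map $f:X\to Y$ is contiguous if there is $k$ with $f(x_i)=y_{k+i-1}$ for all $i\in\{1,\dots,n\}$. The consecutive embedding order: $(X,\rho)\le(Y,\sigma)$ iff there is a contiguous map $f:X\to Y$ such that $(x,y)\in\rho\Leftrightarrow(f(x),f(y))\in\sigma$ for all $x,y\in X$. Write $\rho\cong\sigma$ (isomorphic) if such an $f$ exists which is a bijection. Isomorphic relations are considered equal (so one may take the underlying set to be $[1,n]=\{1,\dots,n\}$), and this gives a poset. $\mathrm{Av}(B)$ is the set of equivalence relations $\sigma$ with $\rho\not\le\sigma$ for all $\rho\in B$. A downward closed set $C$ is atomic if it is not a union of two downward closed proper subsets of $C$; equivalently, for all $x,y\in C$ there is $z\in C$ with $x\le z$ and $y\le z$ (joint embedding property). Factor graph. For a subset $S$ of the underlying set, $\rho{\upharpoonright}_S$ is the restriction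 of $\rho$ to $S$, and $\rho{\downarrow}$ is the unique relation isomorphic to $\rho$ with underlying set $[1,|\rho|]$. The factor graph $\Gamma_B$ is the digraph whose vertices are the equivalence relations on $[1,b]$ that belong to $C$, with an edge from $\mu$ to $\nu$ (loops allowed) iff $\mu{\upharpoonright}_{[2,b]}\cong\nu{\upharpoonright}_{[1,b-1]}$. For $\rho\in C$ with underlying set $[1,n]$, $n\ge b$, $\Pi(\rho)$ is the path $\rho{\upharpoonright}_{[1,b]}\to\rho{\upharpoonright}_{[2,b+1]}{\downarrow}\to\dots\to\rho{\upharpoonright}_{[n-b+1,n]}{\downarrow}$ in $\Gamma_B$. A vertex of $\Gamma_B$ is special if the equivalence class of its largest entry $b$ has size one. For $\sigma\in C$ with $|\sigma|\ge b$, a class of $\sigma$ is inactive if it contains none of the largest $b-1$ elements of $\sigma$. A special vertex $\nu$ is ambiguous if there is a vertex $\mu$ such that $(\mu,\nu)$ is an edge and there is $\sigma\in C$ with $|\sigma|\ge b$ such that $\sigma$ has an inactive class and $\Pi(\sigma)$ ends at $\mu$. Digraph terms. A path is a sequence of vertices $v_1\to\dots\to v_n$ with each $(v_i,v_{i+1})$ an edge; its length is $n-1$. A path is simple if its vertices are distinct. A cycle is a path of length at least one with $v_1=v_n$; it is simple if $v_1,\dots,v_{n-1}$ are distinct. A digraph is strongly connected if there is a path between any pair of vertices (in each direction). A digraph is a bicycle if it consists of two disjoint simple cycles (the initial and the terminal cycle) connected by a simple path (from the initial to the terminal cycle), where only the start and end vertices of the path are in either cycle. Either of the cycles can be empty,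 and if one cycle is empty then the connecting path may be absent as well; if neither cycle is empty then the connecting path must have length at least one.
   Formalization: Added hypothesis: if C is non-empty, it contains a relation of length b. Otherwise the claim can fail: for B = both relations of length 2, C is the one-point relation, which is atomic, yet (i) fails. Only non-empty C with all lengths below b are excluded. *)

(* Defs.v *)
From HB Require Import structures.
From mathcomp Require Import all_boot.
From mathcomp Require Import finmap.
From mathcomp Require Import classical_sets.

Set Implicit Arguments.
Unset Strict Implicit.
Unset Printing Implicit Defensive.

Local Open Scope nat_scope.

(* Isomorphic relations are identified, so the underlying set of a relation of
   length n is taken to be [1,n]; the entry i.+1 of [1,n] is encoded by i : 'I_n.
   A relation is the set of its pairs.  Length 0 is allowed in [erel] only so
   that the restrictions to b-1 points below make sense for b = 1. *)
Definition is_equiv n (r : {set 'I_n * 'I_n}) : bool :=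
  [&& [forall x, (x, x) \in r],
      [forall x, forall y, ((x, y) \in r) ==> ((y, x) \in r)] &
      [forall x, forall y, forall z,
         ((x, y) \in r) && ((y, z) \in r) ==> ((x, z) \in r)]].

Record erel (n : nat) := Erel {
  pairs :> {set 'I_n * 'I_n};
  erelP : is_equiv pairs }.

HB.instance Definition _ n := [isSub for @pairs n].
HB.instance Definition _ n := [Finite of erel n by <:].

Definition eqvrel := {n : nat & erel n.+1}.
HB.instance Definition _ := Choice.on eqvrel.

Definition EqRel n (r : erel n.+1) : eqvrel := Tagged (fun n => erel n.+1) r.
Definition len (rho : eqvrel) : nat := (tag rho).+1.
Definition rel_of (rho : eqvrel) : erel (len rho) := tagged rho.

Definition eclass n (r : erel n) (x : 'I_n) : {set 'I_n} :=
  finset (fun y => (x, y) \in pairs r).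

Definition contiguous m n (f : {ffun 'I_m -> 'I_n}) : bool :=
  [exists k : 'I_n, [forall i : 'I_m, f i == k + i :> nat]].

Definition emb (rho sigma : eqvrel) : bool :=
  [exists f : {ffun 'I_(len rho) -> 'I_(len sigma)},
     contiguous f &&
     [forall x, forall y,
        ((x, y) \in pairs (rel_of rho)) ==
        ((f x, f y) \in pairs (rel_of sigma))]].

Definition Av (B : {fset eqvrel}) : pred eqvrel :=
  [pred sigma | all (fun rho => ~~ emb rho sigma) B].

Definition maxlen (B : {fset eqvrel}) : nat := \max_(rho <- B) len rho.

Local Open Scope classical_set_scope.

Definition down_closed (C : set eqvrel) : Prop :=
  forall rho sigma, emb rho sigma -> C sigma -> C rho.

Definition atomic (C : set eqvrel) : Prop :=
  ~ exists D E : set eqvrel,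
      [/\ down_closed D, down_closed E, D `<` C, E `<` C & C = D `|` E].

Local Close Scope classical_set_scope.

Lemma pull_subproof m n (f : 'I_m -> 'I_n) (r : erel n) :
  is_equiv (finset (fun xy => (f xy.1, f xy.2) \in pairs r)).
Proof.
case/and3P: (erelP r) => /forallP r1 /forallP r2 /forallP r3.
apply/and3P; split.
- by apply/forallP => x; rewrite inE.
- apply/forallP => x; apply/forallP => y; rewrite !inE /=.
  by move/forallP: (r2 (f x)).
- apply/forallP => x; apply/forallP => y; apply/forallP => z; rewrite !inE /=.
  by move/forallP: (r3 (f x)) => /(_ (f y)) /forallP.
Qed.

Definition pull m n (f : 'I_m -> 'I_n) (r : erel n) : erel m :=
  Erel (pull_subproof f r).

(* The restriction of r to the m entries [i+1, i+m], relabelled by [1,m];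
   meaningful only when i + m <= n.+1. *)
Definition restr (i m n : nat) (r : erel n.+1) : erel m :=
  pull (fun x : 'I_m => inord (i + x) : 'I_n.+1) r.

Section Digraph.
Variables (T : finType) (e : rel T).

Definition strongly_connected : Prop := forall x y : T, connect e x y.

Definition path_arcs (p : seq T) : seq (T * T) := zip p (behead p).

(* A simple cycle v_1 -> ... -> v_n = v_1 is given by [:: v_1; ...; v_(n-1)]. *)
Definition cycle_arcs (c : seq T) : seq (T * T) := zip c (rot 1 c).

(* c1 and c2 are the initial and terminal cycles and p is the connecting path;
   [::] stands for an empty cycle and for an absent path.  A path with vertex
   sequence p has length (size p).-1. *)
Definition bicycle_on (c1 p c2 : seq T) : Prop :=
  [/\ [/\ ucycle e c1, ucycle e c2 & ~~ has (mem c1) c2],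
      sorted e p /\ uniq p,
      [/\ c1 != [::] -> {in p, forall x, (x \in c1) = (x == head x p)},
          c2 != [::] -> {in p, forall x, (x \in c2) = (x == last x p)} &
          c1 != [::] -> c2 != [::] -> 1 < size p],
      forall x, [|| x \in c1, x \in p | x \in c2] &
      forall x y, e x y =
        [|| (x, y) \in cycle_arcs c1, (x, y) \in path_arcs p
          | (x, y) \in cycle_arcs c2]].

Definition bicycle : Prop := exists c1 p c2 : seq T, bicycle_on c1 p c2.

End Digraph.

Section FactorGraph.
Variable B : {fset eqvrel}.

Local Notation b := (maxlen B).

(* For non-empty B one has b = b.-1.+1. *)
Definition vertex := {r : erel b.-1.+1 | EqRel r \in Av B}.

(* The only contiguous bijection of [1,b-1] onto itself is the identity, so the
   two relabelled restrictions are isomorphic iff they are equal. *)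
Definition edge : rel vertex :=
  [rel mu nu | restr 1 b.-1 (val mu) == restr 0 b.-1 (val nu)].

(* The vertex sequence of the path Pi(rho); used only when b <= len rho. *)
Definition Pi (rho : eqvrel) : seq (erel b.-1.+1) :=
  [seq restr i b.-1.+1 (tagged rho) | i <- iota 0 (len rho - b).+1].

Definition special (nu : vertex) : bool :=
  #|eclass (val nu) ord_max| == 1.

(* The largest b-1 elements of [1,n] are those encoded by y with
   n - (b-1) <= y. *)
Definition has_inactive_class (sigma : eqvrel) : bool :=
  [exists x : 'I_(len sigma),
     [forall y in eclass (rel_of sigma) x, y < len sigma - b.-1]].

Definition ambiguous (nu : vertex) : Prop :=
  special nu /\
  exists2 mu : vertex, edge mu nu &
    exists sigma : eqvrel,
      [/\ sigma \in Av B, b <= len sigma, has_inactive_class sigma &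
          exists p, Pi sigma = rcons p (val mu)].

End FactorGraph.

(* Main.v *)
(* Avoidance depends only on the windows of length b, so the relations in Av B of
   length at least b project onto the nonempty walks of the factor graph, and two
   of them can be amalgamated along any edge joining their walks.  If the factor
   graph is strongly connected, joint embedding follows by amalgamating along a
   connecting walk.  Otherwise joint embedding of walks means that there is an
   edge x -> y, not on any closed walk, such that the walks leaving y and those
   arriving at x are deterministic; such graphs are exactly the bicycles that are
   not strongly connected.  In that case a walk through x -> y visits this edge
   only once, so two relations with a common walk can be jointly embedded only if
   they are equal: walks must determine relations, and this is the absence of
   ambiguous vertices. *)
Require Import Defs.
From mathcomp Require Import all_boot.
From mathcomp Require Import finmap.
From mathcomp Require Import classical_sets.
From mathcomp Require Import boolp zify.

Set Implicit Arguments.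
Unset Strict Implicit.
Unset Printing Implicit Defensive.

(** * Digraphs with joint embedding of walks *)

Section Walks.
Variables (T : finType) (e : rel T).
Implicit Types (u v w x y z : T) (s t r a d : seq T).

Definition walk_jep : Prop :=
  forall s t, 0 < size s -> 0 < size t -> sorted e s -> sorted e t ->
  exists r, [/\ sorted e r, infix s r & infix t r].

(** [bridge_cut] and [bridge_cover] split the vertices into those that reach x and those reachable
    from y. By [bridge_cross], x -> y is the only edge from the first part to the second, and none
    leads back. *)
Record bridge x y : Prop := Bridge {
  bridge_edge : e x y;
  bridge_cut : ~~ connect e y x;
  bridge_cover : forall v, connect e v x || connect e y v;
  bridge_out : forall u v w, connect e y u -> e u v -> e u w -> v = w;
  bridge_in : forall u v w, connect e u x -> e v u -> e w u -> v = w;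
  bridge_cross : forall u v,
    connect e u x -> connect e y v -> e u v -> u = x /\ v = y }.

Lemma connect_last x p v : path e x p -> v \in x :: p -> connect e v (last x p).
Proof.
move=> ep; rewrite in_cons => /predU1P[->|vp].
  by apply/connectP; exists p.
case/splitPr: vp ep => p1 p2 ep; apply/connectP; exists p2; last by rewrite last_cat.
by move: ep; rewrite cat_path /= => /and3P[].
Qed.

Lemma sorted_cat_connect a x d : sorted e (a ++ x :: d) ->
  {in rcons a x, forall v, connect e v x} /\ {in x :: d, forall v, connect e x v}.
Proof.
rewrite sorted_cat_cons => /andP[ea ed]; split=> v; last first.
  by move=> vd; apply: (path_connect ed).
rewrite -cats1 in ea *; case: a ea => [|u a] /= ea va.
  by move: va; rewrite inE => /eqP->.
by have := connect_last ea va; rewrite last_cat.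
Qed.

(** Of two arcs at different places of a walk, the earlier one ends at a vertex that reaches the
    start of the later one. When y does not reach x, a walk therefore crosses x -> y at most
    once. *)
Lemma arc_order r x y u v a d a' d' :
  sorted e r -> r = a ++ x :: y :: d -> r = a' ++ u :: v :: d' ->
  [\/ [/\ a = a', x = u, y = v & d = d'], connect e y u | connect e v x].
Proof.
move=> er rE; subst r; elim: a a' er => [|z a IH] [|z' a'] /= er.
- by case=> <- <- <-; constructor 1.
- case=> _ E; constructor 2; move: er => /andP[_ er].
  by apply: (path_connect er); rewrite E mem_cat in_cons eqxx orbT.
- case=> _ E; constructor 3; rewrite E in er.
  case/andP: er => _ er; apply: (path_connect er).
  case: a E {IH er} => [|z' a] /= [].
    by move=> -> _; rewrite mem_head.
  by move=> _ <-; rewrite inE mem_cat mem_head !orbT.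
- case=> <- E; have er' := path_sorted er.
  case: (IH a' er' E) => [[-> -> -> ->]|yu|vx]; first by constructor 1.
    by constructor 2.
  by constructor 3.
Qed.

(** If every edge could be undone by a walk, reachability would be symmetric, and a walk through two
    given vertices would connect them both ways. *)
Lemma cut_edge_exists : walk_jep -> ~ strongly_connected e ->
  exists x y, e x y /\ ~~ connect e y x.
Proof.
move=> J nsc.
have [/existsP[x /existsP[y /andP[]]]|/existsPn ncut] :=
  boolP [exists x, exists y, e x y && ~~ connect e y x]; first by exists x, y.
have back u v : connect e u v -> connect e v u.
  case/connectP=> p; elim: p u => [|w p IH] u /=; first by move=> _ ->.
  case/andP=> uw /IH{}IH /IH wu; apply: connect_trans wu _.
  by move/existsPn: (ncut u) => /(_ w); rewrite uw negbK.
case: nsc => u v.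
have [r [er /infixP[a [d rE]] vr]] := J [:: u] [:: v] isT isT isT isT.
move: (mem_infix vr) => /(_ v (mem_head _ _)).
rewrite rE in er * => /=; have [au ud] := sorted_cat_connect er.
rewrite mem_cat => /orP[va|]; last exact: ud.
by apply/back/au; rewrite mem_rcons in_cons va orbT.
Qed.

(** The remaining fields come from jointly embedding a walk through x -> y with a second walk. The
    edge occurs only once in the common walk, which aligns two walks that both contain it. *)
Lemma cut_edge_bridge x y :
  walk_jep -> e x y -> ~~ connect e y x -> bridge x y.
Proof.
move=> J exy cut.
have once a d a' d' : sorted e (a ++ x :: y :: d) ->
    a ++ x :: y :: d = a' ++ x :: y :: d' -> a = a' /\ d = d'.
  by move=> er E; have [[]|/(negP cut)|/(negP cut)] := arc_order er erefl E.
have xy : sorted e [:: x; y] by rewrite /= exy.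
split=> //.
- move=> v; have [r [er /infixP[a [d rE]] vr]] := J [:: x; y] [:: v] isT isT xy isT.
  move: (mem_infix vr) => /(_ v (mem_head _ _)).
  rewrite rE /= in er *; have [ax _] := sorted_cat_connect er.
  rewrite -cat_rcons in er *; have [_ yd] := sorted_cat_connect er.
  rewrite mem_cat => /orP[va|]; last by move/yd->; rewrite orbT.
  by rewrite ax.
- move=> u v w /connectP[p ep uE] euv euw.
  have walk v' : e u v' -> sorted e (x :: y :: rcons p v').
    by move=> uv'; rewrite /= exy rcons_path ep -uE.
  have [r [er /infixP[a [d rE]] /infixP[a' [d' rE']]]] :=
    J (_ :: _) (_ :: _) isT isT (walk v euv) (walk w euw).
  rewrite rE in er; rewrite rE /= in rE'.
  have [_ /eqP] := once _ _ _ _ er rE'.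
  by rewrite eqseq_cat ?size_rcons // eqseq_rcons => /andP[/andP[_ /eqP]].
- move=> u v w /connectP[p ep xE] evu ewu.
  have walk v' : e v' u -> sorted e (v' :: u :: rcons p y).
    by move=> uv'; rewrite /= uv' rcons_path ep -xE.
  have [r [er /infixP[a [d rE]] /infixP[a' [d' rE']]]] :=
    J (_ :: _) (_ :: _) isT isT (walk v evu) (walk w ewu).
  have split v' b c :
    b ++ (v' :: u :: rcons p y) ++ c = (b ++ v' :: belast u p) ++ x :: y :: c.
    by rewrite /= cat_rcons -catA /= -(cat_rcons x) {1}xE -lastI.
  rewrite rE split in er; rewrite rE !split in rE'.
  have [E _] := once _ _ _ _ er rE'.
  have /eqP : size a = size a' by move/(congr1 size): E; rewrite !size_cat /=; lia.
  by move: E => /eqP; move=> + /eqP sa; rewrite eqseq_cat // => /andP[_ /eqP[]].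
- move=> u v ux yv euv.
  have uv : sorted e [:: u; v] by rewrite /= euv.
  have [r [er /infixP[a [d rE]] /infixP[a' [d' rE']]]] := J (_ :: _) (_ :: _) isT isT xy uv.
  have [[_ -> -> _] //|yu|vx] := arc_order er rE rE'.
    by case/negP: cut; apply: connect_trans ux.
  by case/negP: cut; apply: connect_trans vx.
Qed.

(** * Joint embedding of walks from a bridge *)

(** The first vertex of the walk that does not reach x is reachable from y by [bridge_cover], so the
    step into it is x -> y by [bridge_cross]. *)
Lemma bridge_mem_arc x y u s : bridge x y -> path e u s ->
  connect e u x -> ~~ connect e (last u s) x ->
  exists a d, u :: s = a ++ x :: y :: d.
Proof.
move=> br; elim: s u => [|v s IH] u /=; first by move=> _ ->.
case/andP=> euv es ux nx; have [vx|vx] := boolP (connect e v x).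
  by have [a [d ->]] := IH v es vx nx; exists (u :: a), d.
have yv : connect e y v by have := bridge_cover br v; rewrite (negPf vx).
by have [<- <-] := bridge_cross br ux yv euv; exists [::], s.
Qed.

(** A walk starting beyond the bridge is preceded by a walk from y, one ending before it is followed
    by a walk to x, and any other walk already crosses it. *)
Lemma bridge_extend x y s : bridge x y -> sorted e s -> 0 < size s ->
  exists a d, sorted e (a ++ x :: y :: d) /\ infix s (a ++ x :: y :: d).
Proof.
move=> br; case: s => // u s /= es _.
have [ux|nux] := boolP (connect e u x); last first.
  have yu : connect e y u by have := bridge_cover br u; rewrite (negPf nux).
  case/connectP: yu => p ep uE; exists [::], (p ++ s); split.
    by rewrite /= (bridge_edge br) cat_path ep -uE.
  apply/infixP; exists (x :: belast y p), [::].
  by rewrite cats0 /= uE -cat_rcons -lastI.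
have [lx|nlx] := boolP (connect e (last u s) x); last first.
  have [a [d sE]] := bridge_mem_arc br es ux nlx.
  by exists a, d; rewrite -sE infix_refl.
case/connectP: lx => p ep xE.
have E : u :: s ++ rcons p y = belast u (s ++ p) ++ [:: x; y].
  by rewrite -(cat_rcons x) {1}xE -last_cat -lastI /= -catA cats1.
exists (belast u (s ++ p)), [::]; rewrite -E; split.
  by rewrite /= cat_path es rcons_path ep -xE (bridge_edge br).
by apply/infixP; exists [::], (rcons p y).
Qed.

(** Without branching beyond z, one of d and d' is a prefix of the other, and D is the longer
    one. *)
Lemma out_det_prefix z d d' :
  (forall u v w, connect e z u -> e u v -> e u w -> v = w) ->
  path e z d -> path e z d' ->
  exists D, [/\ path e z D, prefix d D & prefix d' D].
Proof.
elim: d z d' => [|v d IH] z [|v' d'] det //= ed ed'; try by exists [::].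
- by exists (v' :: d'); split=> //; apply: prefix_refl.
- by exists (v :: d); split=> //; apply: prefix_refl.
case/andP: ed => zv ed; case/andP: ed' => zv' ed'.
have vE := det _ _ _ (connect0 _ _) zv zv'; rewrite -{v'}vE in zv' ed' *.
have [|D [eD dD d'D]] := IH v d' _ ed ed'.
  by move=> u w w' vu; apply: det; apply: connect_trans vu; apply: connect1.
by exists (v :: D); rewrite /= zv eD !eqxx dD d'D.
Qed.

End Walks.

Definition rev_rel (T : Type) (e : rel T) : rel T := fun x y => e y x.

Lemma bridge_rev (T : finType) (e : rel T) x y :
  bridge e x y -> bridge (rev_rel e) y x.
Proof.
have cE u v : connect (rev_rel e) u v = connect e v u.
  by have := connect_rev e u v => /= <-; apply: eq_connect.
case=> exy cut cov out inn cross; split; rewrite ?cE //.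
- by move=> v; rewrite !cE orbC.
- by move=> u v w; rewrite cE; apply: inn.
- by move=> u v w; rewrite cE; apply: out.
- by move=> u v; rewrite !cE => yu vx evu; have [-> ->] := cross v u vx yu evu.
Qed.

(** Both walks extend across x -> y. Past y one extension prolongs the other, and likewise backwards
    from x, so the longer part on each side gives a common walk. *)
Lemma bridge_jep (T : finType) (e : rel T) x y : bridge e x y -> walk_jep e.
Proof.
move=> br s t s0 t0 es et.
have [a [d [er sr]]] := bridge_extend br es s0.
have [a' [d' [er' tr]]] := bridge_extend br et t0.
have split b c : sorted e (b ++ x :: y :: c) =
    [&& path (rev_rel e) x (rev b), e x y & path e y c].
  rewrite sorted_cat_cons /=; congr (_ && _).
  by rewrite -[RHS]/(sorted (rev_rel e) (x :: rev b)) -rev_rcons rev_sorted.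
move: er er'; rewrite !split => /and3P[ea exy ed] /and3P[ea' _ ed'].
have [D [eD /prefixP[q DE] /prefixP[q' DE']]] :=
  out_det_prefix (bridge_out br) ed ed'.
have [A [eA /prefixP[p AE] /prefixP[p' AE']]] :=
  out_det_prefix (bridge_out (bridge_rev br)) ea ea'.
(* The part before x is read from x backwards, so a prefix of [A] becomes, after reversal, a suffix
   of what precedes x. *)
have grow b c l m w : A = rev b ++ l -> D = c ++ m ->
    infix w (b ++ x :: y :: c) -> infix w (rev A ++ x :: y :: D).
  move=> -> -> /infixP[f [g E]]; rewrite rev_cat revK.
  apply/infixP; exists (rev l ++ f), (g ++ m).
  by rewrite -[y :: _]/((y :: c) ++ m) -[x :: _]/((x :: y :: c) ++ m)
    -catA (catA b) E -!catA.
exists (rev A ++ x :: y :: D); split.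
- by rewrite split revK eA exy.
- exact: grow AE DE sr.
- exact: grow AE' DE' tr.
Qed.

(** * Arcs of paths and cycles; bridges and bicycles *)

Lemma path_arcsP (T : finType) (s : seq T) u v :
  reflect (exists a d, s = a ++ u :: v :: d) ((u, v) \in path_arcs s).
Proof.
apply: (iffP idP) => [|[a [d ->]]].
  elim: s => [|x [|y s] IH] //; rewrite in_cons => /predU1P[[-> ->]|/IH].
    by exists [::], s.
  by case=> a [d E]; exists (x :: a), d; rewrite E.
by elim: a => [|x [|y a] IH] /=; rewrite in_cons ?eqxx // IH orbT.
Qed.

Lemma path_arcs_cat (T : finType) (a d : seq T) x :
  path_arcs (a ++ x :: d) = path_arcs (rcons a x) ++ path_arcs (x :: d).
Proof. by elim: a => [|y [|z a] IH] //=; congr (_ :: _). Qed.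

Lemma path_arcs_rev (T : finType) (s : seq T) u v :
  ((u, v) \in path_arcs (rev s)) = ((v, u) \in path_arcs s).
Proof.
have sub t w z : (w, z) \in path_arcs t -> (z, w) \in path_arcs (rev t).
  case/path_arcsP => a [d ->]; apply/path_arcsP; exists (rev d), (rev a).
  by rewrite rev_cat !rev_cons -!cats1 -!catA.
by apply/idP/idP => /sub; rewrite ?revK.
Qed.

Lemma cycle_arcs_path (T : finType) (x : T) s :
  cycle_arcs (x :: s) = path_arcs (x :: rcons s x).
Proof.
rewrite /cycle_arcs rot1_cons /path_arcs /=.
suff trunc z : zip (z :: s) (rcons s x) = zip (z :: rcons s x) (rcons s x) by [].
by elim: s z => [|y s IH] z //=; rewrite -IH.
Qed.

Lemma cycle_arcs_next (T : finType) (c : seq T) u v : uniq c ->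
  ((u, v) \in cycle_arcs c) = (u \in c) && (v == next c u).
Proof.
case: c => // x c Uc; rewrite /cycle_arcs rot1_cons.
have sz : size (rcons c x) = size (x :: c) by rewrite size_rcons.
(* The default value of [nth], the first vertex x of the cycle, is the successor of its last
   vertex. *)
rewrite next_nth; apply/idP/andP => [/(nthP (x, x))[i]|[uc]].
  rewrite size_zip sz minnn nth_zip // => ilt [<- <-].
  by rewrite mem_nth // index_uniq // nth_rcons_default eqxx.
rewrite uc => /eqP->; apply/(nthP (x, x)); exists (index u (x :: c)).
  by rewrite size_zip sz minnn index_mem.
by rewrite nth_zip // nth_index // nth_rcons_default.
Qed.

Lemma cycle_arcs_rev (T : finType) (c : seq T) u v : uniq c ->
  ((u, v) \in cycle_arcs (rev c)) = ((v, u) \in cycle_arcs c).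
Proof.
move=> Uc; rewrite !cycle_arcs_next ?rev_uniq // mem_rev next_rev //.
apply/andP/andP => [][uc /eqP->]; rewrite ?mem_prev ?mem_next uc.
  by rewrite next_prev.
by rewrite prev_next.
Qed.

(* What is reachable from y when every vertex reachable from y has at most one
   successor: a simple path s from y that ends at a sink (c empty) or runs into
   a simple cycle c. *)
Lemma lollipop (T : finType) (e : rel T) y :
  (forall u v w, connect e y u -> e u v -> e u w -> v = w) ->
  exists s c, [/\ path e y s /\ uniq (y :: s), ucycle e c,
    c != [::] -> {in y :: s, forall x, (x \in c) = (x == last y s)},
    forall v, connect e y v = (v \in y :: s) || (v \in c) &
    forall u v, connect e y u ->
      e u v = ((u, v) \in path_arcs (y :: s)) || ((u, v) \in cycle_arcs c)].
Proof.
move=> det.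
have [q [eq Uq qmax]] : exists q, [/\ path e y q, uniq (y :: q) &
    forall w, e (last y q) w -> w \in y :: q].
  suff ext n p : path e y p -> uniq (y :: p) -> #|T| <= n + size p ->
      exists q, [/\ path e y q, uniq (y :: q) &
        forall w, e (last y q) w -> w \in y :: q].
    by apply: (ext #|T| [::]); rewrite // addn0.
  elim: n p => [|n IH] p ep Up szp.
    have := max_card (mem (y :: p)); rewrite (card_uniqP Up) /= => szq.
    by have := leq_trans szq szp; rewrite ltnn.
  have [/existsP[w /andP[ew wp]]|/existsPn stop] :=
    boolP [exists w, e (last y p) w && (w \notin y :: p)].
    apply: (IH (rcons p w)); rewrite ?size_rcons ?addnS //.
      by rewrite rcons_path ep.
    by rewrite -rcons_cons rcons_uniq wp.
  exists p; split=> // w ew; move/(_ w): stop; rewrite ew.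
  by rewrite negbK.
have reach u : u \in y :: q -> connect e y u by apply: path_connect.
have arcs_e a : path e y a -> forall u v, (u, v) \in path_arcs (y :: a) -> e u v.
  move=> ea u v /path_arcsP[b [d E]].
  have : sorted e (y :: a) by []; rewrite E sorted_cat_cons /=.
  by case/andP=> _ /andP[].
have succ u : u \in y :: q ->
    u = last y q \/ exists v, (u, v) \in path_arcs (y :: q).
  move=> uq; case/splitPr E: {1}(y :: q) / uq => [a [|v d]].
    by left; rewrite -[LHS](last_cat y a [:: u]) -/(last u _) -E.
  by right; exists v; apply/path_arcsP; exists a, d.
(* If p has an outgoing arc at each vertex of [y :: q] that has an outgoing edge, determinism leaves
   no other edge there, and nothing outside [y :: q] is reachable. This serves for p = q at a sink
   and for p = [rcons q w] otherwise. *)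
have close p : path e y p -> {subset p <= y :: q} ->
    (forall u v, u \in y :: q -> e u v ->
       exists v', (u, v') \in path_arcs (y :: p)) ->
    (forall v, connect e y v = (v \in y :: q)) /\
    (forall u v, connect e y u -> e u v = ((u, v) \in path_arcs (y :: p))).
  move=> ep pq total.
  have arcE u v : u \in y :: q -> e u v = ((u, v) \in path_arcs (y :: p)).
    move=> uq; apply/idP/idP => [euv|]; last exact: arcs_e.
    have [v' uv'] := total u v uq euv.
    by rewrite (det u v v' (reach u uq) euv (arcs_e _ ep _ _ uv')).
  have stay v : connect e y v -> v \in y :: q.
    case/connectP=> t; elim/last_ind: t v => [|t w IH] v /=.
      by move=> _ ->; apply: mem_head.
    rewrite rcons_path last_rcons => /andP[et etw] ->.
    have lq := IH _ et erefl; move: etw; rewrite arcE // => /path_arcsP[a [d E]].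
    have : w \in y :: p by rewrite E mem_cat !inE eqxx !orbT.
    by rewrite in_cons => /predU1P[->|/pq//]; apply: mem_head.
  split=> [v|u v yu]; first by apply/idP/idP; [apply: stay | apply: reach].
  exact/arcE/stay.
have [/existsP[w ew]|/existsPn sink] := boolP [exists w, e (last y q) w]; last first.
  have [|||conn arcE] := close q.
  - by [].
  - by move=> u uq; rewrite in_cons uq orbT.
  - move=> u v uq euv; case: (succ u uq) => // uE.
    by move: (sink v); rewrite -uE euv.
  exists q, [::]; split=> // [v|u v yu]; first by rewrite conn orbF.
  by rewrite arcE ?orbF.
(* The successor w of the last vertex lies on the path: the part from w on becomes the cycle, and
   the simple path s ends at w. *)
have wq := qmax w ew.
have eqw : path e y (rcons q w) by rewrite rcons_path eq.
have [|||conn arcE] := close (rcons q w).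
- by [].
- by move=> u; rewrite mem_rcons in_cons => /predU1P[->//|uq]; rewrite in_cons uq orbT.
- move=> u v uq _; case: (succ u uq) => [->|[v' /path_arcsP[a [d E]]]].
    exists w; apply/path_arcsP; exists (belast y q), [::].
    by rewrite -cat_rcons -lastI cats1.
  exists v'; apply/path_arcsP; exists a, (rcons d w).
  by rewrite -rcons_cons E rcons_cat.
have [a [d E]] : exists a d, y :: q = a ++ w :: d.
  by case/splitPr: wq => a d; exists a, d.
have [s sE] : exists s, rcons a w = y :: s.
  by case: a E => [|z a] /= [-> _]; [exists [::] | exists (rcons a w)].
have lastE : last y s = w by rewrite -[LHS]/(last y (y :: s)) -sE last_rcons.
have qE : y :: q = (y :: s) ++ d by rewrite -sE cat_rcons.
have eqE : y :: rcons q w = a ++ w :: rcons d w.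
  by rewrite -rcons_cons E rcons_cat.
have Ud : uniq (w :: d) by move: Uq; rewrite E cat_uniq => /and3P[].
exists s, (w :: d); split.
- split; first by move: eq; rewrite -[path _ _ _]/(sorted e (y :: q)) qE => /cat_sorted2[].
  by move: Uq; rewrite qE cat_uniq => /and3P[].
- apply/andP; split=> //=; move: (eqw); rewrite -[path _ _ _]/(sorted e (y :: rcons q w)) eqE.
  by rewrite sorted_cat_cons => /andP[].
- move=> _ x; rewrite lastE -sE mem_rcons !in_cons.
  have [-> //|_ /= xa] := eqVneq x w.
  apply/negbTE/negP => xd; move: Uq; rewrite E cat_uniq => /and3P[_ /hasP[]].
  by exists x => //; rewrite inE xd orbT.
- move=> v; rewrite conn E -sE mem_cat mem_rcons !inE.
  by case: (v == w); case: (v \in a); case: (v \in d).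
- move=> u v yu; rewrite arcE // eqE path_arcs_cat mem_cat -sE.
  by rewrite cycle_arcs_path.
Qed.

(** [lollipop] from y gives the terminal side and, from x in the reversed digraph, the initial side.
    The edge x -> y joins their paths; a sink or a source leaves the corresponding cycle empty. *)
Lemma bridge_bicycle (T : finType) (e : rel T) x y : bridge e x y -> bicycle e.
Proof.
move=> br.
have cE u v : connect (rev_rel e) u v = connect e v u.
  by have := connect_rev e u v => /= <-; apply: eq_connect.
have [s2 [c2 [[es2 Us2] Cc2 head2 conn2 arc2]]] := lollipop (bridge_out br).
have [s1 [c1 [[es1 Us1] /andP[Cc1 Uc1] head1 conn1 arc1]]] :=
  lollipop (bridge_out (bridge_rev br)).
have sep v : connect e v x -> connect e y v -> False.
  by move=> vx yv; case/negP: (bridge_cut br); apply: connect_trans vx.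
have in1 v : (v \in x :: s1) || (v \in c1) -> connect e v x.
  by rewrite -conn1 cE.
have in2 v : (v \in y :: s2) || (v \in c2) -> connect e y v by rewrite -conn2.
have lastp z : last z (rev (x :: s1) ++ y :: s2) = last y s2 by rewrite last_cat.
have headp z : head z (rev (x :: s1) ++ y :: s2) = last x s1.
  by rewrite lastI rev_rcons.
exists (rev c1), (rev (x :: s1) ++ y :: s2), c2; split.
- split=> //; first by rewrite /ucycle rev_uniq rev_cycle Cc1.
  apply/hasPn => v vc2; rewrite inE /= mem_rev; apply/negP => vc1.
  by apply: (sep v); [apply: in1 | apply: in2]; rewrite ?vc1 ?vc2 orbT.
- split.
    rewrite sorted_cat_cons es2 andbT -rev_cons rev_sorted.
    by apply/andP; split; [apply: bridge_edge br | apply: es1].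
  rewrite cat_uniq rev_uniq Us1 Us2 andbT andTb.
  apply/hasPn => v vs; rewrite mem_rev; apply/negP => vs1.
  by apply: (sep v); [apply: in1; rewrite vs1 | apply: in2; rewrite vs].
- split.
  + rewrite -size_eq0 size_rev size_eq0 => c10 v; rewrite headp mem_cat !mem_rev.
    case/orP=> vs; first exact: head1.
    have yv : connect e y v by apply: in2; rewrite vs.
    apply/idP/eqP => [vc|vE]; case: (sep v) => //; apply: in1.
      by rewrite vc orbT.
    by rewrite vE mem_last.
  + move=> c20 v; rewrite lastp mem_cat mem_rev => /orP[vs|]; last exact: head2.
    have vx : connect e v x by apply: in1; rewrite vs.
    apply/idP/eqP => [vc|vE]; case: (sep v) => //; apply: in2.
      by rewrite vc orbT.
    by rewrite vE mem_last.
  + by rewrite size_cat size_rev /=; lia.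
- move=> v; rewrite mem_cat !mem_rev.
  have := bridge_cover br v; rewrite -cE conn1 conn2.
  by case/orP=> /orP[]->; rewrite ?orbT.
- move=> u v; rewrite cycle_arcs_rev // path_arcs_cat -rev_cons mem_cat path_arcs_rev.
  have -> : path_arcs [:: y, x & s1] = (y, x) :: path_arcs (x :: s1) by [].
  rewrite in_cons; apply/idP/idP => [euv|].
    have /orP[ux|yu] := bridge_cover br u; last first.
      by move: euv; rewrite (arc2 _ _ yu) => /orP[]->; rewrite ?orbT.
    have /orP[vx|yv] := bridge_cover br v; last first.
      by have [-> ->] := bridge_cross br ux yv euv; rewrite eqxx /= orbT.
    move: vx euv; rewrite -cE -[e u v]/(rev_rel e v u) => xv; rewrite (arc1 _ _ xv).
    by case/orP=> ->; rewrite ?orbT.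
  case/or3P=> [vu|/orP[/predU1P[[-> ->]|vu]|uv]|uv].
  + rewrite -[e u v]/(rev_rel e v u) arc1 ?vu ?orbT // conn1.
    by move: vu; rewrite cycle_arcs_next // => /andP[->]; rewrite orbT.
  + exact: bridge_edge br.
  + rewrite -[e u v]/(rev_rel e v u) arc1 ?vu // conn1.
    by case/path_arcsP: vu => a [d ->]; rewrite mem_cat mem_head orbT.
  + rewrite arc2 ?uv // conn2.
    by case/path_arcsP: uv => a [d ->]; rewrite mem_cat mem_head orbT.
  + rewrite arc2 ?uv ?orbT // conn2; case/andP: Cc2 => _ Uc2.
    by move: uv; rewrite cycle_arcs_next // => /andP[->]; rewrite orbT.
Qed.

Lemma path_arcs_next (T : finType) (s : seq T) u v : uniq s ->
  (u, v) \in path_arcs s -> v = next s u.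
Proof.
move=> Us /path_arcsP[a [d sE]]; apply/eqP.
suff : (u, v) \in cycle_arcs s by rewrite cycle_arcs_next // => /andP[].
case: s Us sE => [|w s] _ sE; first by case: (a) sE.
rewrite cycle_arcs_path; apply/path_arcsP; exists a, (rcons d w).
by rewrite -rcons_cons sE rcons_cat.
Qed.

Lemma path_arcs_last (T : finType) (x v : T) s : uniq (x :: s) ->
  (last x s, v) \notin path_arcs (x :: s).
Proof.
move=> Us; apply/negP => /path_arcsP[a [d sE]].
have lE : last x s = last v d by rewrite -[LHS]/(last x (x :: s)) sE last_cat.
move: Us; rewrite sE cat_uniq lE => /and3P[_ _ /=].
by rewrite mem_last.
Qed.

(** With at most one vertex on the connecting path, one of the cycles is empty and the digraph is
    strongly connected. Otherwise the first edge of the path is a bridge. *)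
Lemma bicycle_bridge (T : finType) (e : rel T) : bicycle e ->
  strongly_connected e \/ exists x y, bridge e x y.
Proof.
case=> c1 [p [c2 [[C1 C2 C12] [ep Up] [head1 last2 sz] cov arc]]].
have [cc1 Uc1] := andP C1; have [cc2 Uc2] := andP C2.
have cyc c : cycle e c -> (forall v, v \in c) -> strongly_connected e.
  by move=> ec cT u v; apply: (connect_cycle ec).
case: p => [|x [|y p]] in ep Up head1 last2 sz cov arc *.
- left; case: (eqVneq c1 [::]) => [c10|c10].
    by apply: (cyc c2) => // v; have := cov v; rewrite c10.
  case: (eqVneq c2 [::]) => [c20|/(sz c10)//].
  by apply: (cyc c1) => // v; have := cov v; rewrite c20 !orbF.
- left; case: (eqVneq c1 [::]) => [c10|c10].
    case: (eqVneq c2 [::]) => [c20|c20] => [u v|].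
      have := cov u; have := cov v; rewrite c10 c20 !orbF /= !inE.
      by move=> /eqP-> /eqP->.
    apply: (cyc c2) => // v; have := cov v; rewrite c10 in_nil mem_seq1 /= => /orP[/eqP->|//].
    by rewrite last2 ?mem_head.
  case: (eqVneq c2 [::]) => [c20|/(sz c10)//].
  apply: (cyc c1) => // v; have := cov v; rewrite c20 !orbF => /orP[//|].
  by rewrite mem_seq1 => /eqP->; rewrite head1 ?mem_head.
right; exists x, y.
have exy : e x y by case/andP: ep.
have path_e : path e y p by case/andP: ep.
have [xp Uyp] : x \notin y :: p /\ uniq (y :: p) by move/andP: Up.
pose D v := (v \in y :: p) || (v \in c2).
have c12 v : v \in c1 -> v \in c2 = false.
  by move=> v1; apply/negP => v2; case/negP: C12; apply/hasP; exists v.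
have xc2 : x \notin c2.
  case: (eqVneq c2 [::]) => [-> //|c20]; rewrite last2 ?mem_head //=.
  by apply: contraNneq xp => ->; apply: mem_last.
have c1p v : v \in c1 -> v \in y :: p = false.
  move=> v1; apply/negP => vp; have c10 : c1 != [::] by case: (c1) v1.
  have := head1 c10 v; rewrite in_cons vp orbT v1 => /(_ isT)/esym/eqP /= vx.
  by move: xp; rewrite -vx vp.
have c2p v : v \in c2 -> v \in y :: p -> v = last y p.
  move=> v2 vp; have c20 : c2 != [::] by case: (c2) v2.
  by have := last2 c20 v; rewrite in_cons vp orbT v2 => /(_ isT)/esym/eqP.
have c1x v : v \in c1 -> connect e v x.
  move=> v1; apply: (connect_cycle cc1) => //.
  by rewrite head1 ?mem_head //; case: (c1) v1.
have DN v : (v == x) || (v \in c1) = ~~ D v.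
  rewrite /D; case: (eqVneq v x) => [->|vx] /=; first by rewrite (negPf xp).
  have := cov v; rewrite in_cons (negPf vx) /=.
  have := c12 v; have := c1p v; case: (v \in c1) => [->// ->//|_ _ /=].
  by move=> ->.
have arcE u v : e u v = [|| (u, v) \in cycle_arcs c1, (u == x) && (v == y),
    (u, v) \in path_arcs (y :: p) | (u, v) \in cycle_arcs c2].
  by rewrite arc -[path_arcs [:: x, y & p]]/((x, y) :: _) in_cons -!orbA.
have cyc1 u v : (u, v) \in cycle_arcs c1 -> ~~ D u /\ ~~ D v.
  by rewrite cycle_arcs_next // => /andP[u1 /eqP->]; rewrite -!DN mem_next u1 !orbT.
have pathD u v : (u, v) \in path_arcs (y :: p) -> D u /\ D v.
  by case/path_arcsP=> a [d E]; rewrite /D E !mem_cat !inE !eqxx !orbT.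
have cyc2 u v : (u, v) \in cycle_arcs c2 -> D u /\ D v.
  rewrite cycle_arcs_next // => /andP[u2 /eqP->].
  by rewrite /D mem_next u2 !orbT.
have Dx : ~~ D x by rewrite -DN eqxx.
have Dy : D y by rewrite /D mem_head.
have outD u v : D u -> e u v ->
    ((u, v) \in path_arcs (y :: p)) || ((u, v) \in cycle_arcs c2).
  move=> Du; rewrite arcE => /or3P[/cyc1[]|/andP[/eqP uE _]|//]; first by rewrite Du.
  by rewrite uE (negPf Dx) in Du.
have stayD u v : D u -> e u v -> D v.
  by move=> Du /(outD _ _ Du)/orP[/pathD[]|/cyc2[]].
have inN u v : ~~ D v -> e u v -> (u, v) \in cycle_arcs c1.
  move=> Dv; rewrite arcE => /or4P[//|/andP[_ /eqP vE]|/pathD[_]|/cyc2[_]].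
  - by rewrite vE Dy in Dv.
  - by rewrite (negPf Dv).
  - by rewrite (negPf Dv).
have connD u v : D u -> connect e u v -> D v.
  move=> Du /connectP[q]; elim: q u Du => [|w q IH] u Du /=; first by move=> _ ->.
  by case/andP=> /(stayD _ _ Du) Dw; apply: IH.
have ycE v : connect e y v = D v.
  apply/idP/idP; first exact: connD.
  case/orP=> [vp|v2]; first exact: (path_connect path_e).
  have c20 : c2 != [::] by case: (c2) v2.
  have l2 : last y p \in c2 by rewrite last2 // inE mem_last orbT.
  apply: connect_trans (connect_cycle cc2 l2 v2).
  by apply: (path_connect path_e); apply: mem_last.
have cxE v : connect e v x = ~~ D v.
  apply/idP/idP => [vx|]; first by apply: contra Dx => /connD; apply.
  by rewrite -DN => /predU1P[->|/c1x//]; apply: connect0.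
split=> //.
- by rewrite ycE.
- by move=> v; rewrite cxE ycE orNb.
- move=> u v w; rewrite ycE => Du euv euw.
  (* Only the last vertex of the path can lie on the terminal cycle, and no path arc leaves it. *)
  have clash v' : (u, v') \in path_arcs (y :: p) -> u \in c2 -> False.
    move=> uv' u2; have up : u \in y :: p.
      by case/path_arcsP: uv' => a [d ->]; rewrite mem_cat mem_head orbT.
    by move: uv'; rewrite (c2p u u2 up) (negPf (path_arcs_last _ Uyp)).
  have c2u v' : (u, v') \in cycle_arcs c2 -> u \in c2 /\ v' = next c2 u.
    by rewrite cycle_arcs_next // => /andP[-> /eqP].
  case/orP: (outD _ _ Du euv) => uv; case/orP: (outD _ _ Du euw) => uw.
  + by rewrite (path_arcs_next Uyp uv) (path_arcs_next Uyp uw).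
  + by case: (clash v uv); case: (c2u w uw).
  + by case: (clash w uw); case: (c2u v uv).
  + by case: (c2u v uv) => _ ->; case: (c2u w uw) => _ ->.
- move=> u v w; rewrite cxE => Du evu ewu.
  move: (inN _ _ Du evu) (inN _ _ Du ewu).
  rewrite !cycle_arcs_next // => /andP[_ /eqP uE] /andP[_ /eqP].
  by rewrite uE => /(can_inj (prev_next Uc1)).
- move=> u v; rewrite cxE ycE => Du Dv; rewrite arcE.
  case/or4P=> [/cyc1[_]|/andP[/eqP-> /eqP->] //|/pathD[Du']|/cyc2[Du']].
  + by rewrite Dv.
  + by rewrite Du' in Du.
  + by rewrite Du' in Du.
Qed.


(** * Embeddings of relations as maps of labels *)

(* The 0-based position of the least entry in the class of the entry i.+1.  Outside the
   range of s, [inord] makes i a junk entry, whence the bounds in [embat]. *)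
Definition lab (s : eqvrel) (i : nat) : nat :=
  find (fun j => (inord i, inord j) \in pairs (tagged s)) (iota 0 (len s)).

(** A contiguous map is a shift; keeping its offset k explicit allows occurrences to be located and
    compared. *)
Definition embat (k : nat) (r s : eqvrel) : Prop :=
  k + len r <= len s /\
  forall i j, i < len r -> j < len r ->
    (lab r i == lab r j) = (lab s (k + i) == lab s (k + j)).

Lemma erel_refl n (r : erel n) x : (x, x) \in pairs r.
Proof. by case/and3P: (erelP r) => /forallP. Qed.

Lemma erel_sym n (r : erel n) x y : (x, y) \in pairs r -> (y, x) \in pairs r.
Proof. by case/and3P: (erelP r) => _ /forallP/(_ x)/forallP/(_ y)/implyP. Qed.

Lemma erel_trans n (r : erel n) x y z :
  (x, y) \in pairs r -> (y, z) \in pairs r -> (x, z) \in pairs r.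
Proof.
case/and3P: (erelP r) => _ _ /forallP/(_ x)/forallP/(_ y)/forallP/(_ z)/implyP.
by move=> h xy yz; apply: h; rewrite xy.
Qed.

Lemma lab_lt s i : lab s i < len s.
Proof.
rewrite -[X in _ < X](size_iota 0) -has_find; apply/hasP.
exists (nat_of_ord (inord i : 'I_(tag s).+1)); last by rewrite inord_val erel_refl.
by rewrite mem_iota; apply: ltn_ord.
Qed.

Lemma labE s i j : (lab s i == lab s j) = ((inord i, inord j) \in pairs (tagged s)).
Proof.
have hit k : (inord k, inord (lab s k)) \in pairs (tagged s).
  have := lab_lt s k; rewrite -[X in _ < X](size_iota 0) -has_find => /(nth_find 0).
  by rewrite nth_iota ?lab_lt.
apply/eqP/idP => [E|ij].
  by apply: erel_trans (hit i) _; rewrite E; apply: erel_sym.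
apply: eq_find => k; apply/idP/idP; first exact/erel_trans/erel_sym.
exact: erel_trans ij.
Qed.

Lemma embP r s : reflect (exists k, embat k r s) (emb r s).
Proof.
apply: (iffP existsP) => [[f /andP[/existsP[k /forallP fk] /forallP fE]]|].
  have fi i : i < len r -> f (inord i) = inord (k + i) :> 'I_(tag s).+1.
    move=> ri; have fik := eqP (fk (inord i)); rewrite inordK // in fik.
    by apply: val_inj; rewrite -fik inord_val.
  exists k; split=> [|i j ri rj].
    have := ltn_ord (f ord_max); rewrite (eqP (fk ord_max)) /= /len; lia.
  rewrite !labE -!fi //; move/forallP: (fE (inord i)) => /(_ (inord j))/eqP.
  by apply.
case=> k [krs rs].
exists [ffun x : 'I_(len r) => inord (k + x) : 'I_(tag s).+1]; apply/andP; split.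
  have ks : k < (tag s).+1 by move: krs; rewrite /len; lia.
  apply/existsP; exists (Ordinal ks); apply/forallP => x; rewrite ffunE inordK //.
  by have := ltn_ord x; move: krs; rewrite /len; lia.
apply/forallP => x; apply/forallP => y; rewrite !ffunE -labE -rs ?ltn_ord //.
by rewrite labE !inord_val.
Qed.

(** Relations are built as kernels of labellings, for which the equivalence axioms are automatic.
    The index is one less than the length. *)
Definition ker_rel (n : nat) (f : nat -> nat) : {set 'I_n.+1 * 'I_n.+1} :=
  finset (fun xy : 'I_n.+1 * 'I_n.+1 => f xy.1 == f xy.2).

Lemma ker_relP n f : is_equiv (ker_rel n f).
Proof.
apply/and3P; split.
- by apply/forallP => x; rewrite inE.
- by do 2!apply/forallP => ?; rewrite !inE eq_sym implybb.
- do 3!apply/forallP => ?; rewrite !inE /=.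
  by apply/implyP => /andP[/eqP-> /eqP->].
Qed.

Definition ker (n : nat) (f : nat -> nat) : eqvrel := EqRel (Erel (ker_relP n f)).

Lemma lab_ker n f i j : i <= n -> j <= n ->
  (lab (ker n f) i == lab (ker n f) j) = (f i == f j).
Proof. by move=> ni nj; rewrite labE inE /= !inordK. Qed.

Lemma embat_trans k l r s t : embat k r s -> embat l s t -> embat (l + k) r t.
Proof.
move=> [krs rs] [lst st]; split=> [|i j ri rj]; first lia.
rewrite rs // st ?addnA //; lia.
Qed.

Lemma embat_inner k l r s t :
  embat (l + k) r t -> embat l s t -> k + len r <= len s -> embat k r s.
Proof.
move=> [_ rt] [_ st] krs; split=> // i j ri rj.
rewrite rt // st ?addnA //; lia.
Qed.

Lemma embat_refl s : embat 0 s s.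
Proof. by []. Qed.

Lemma embat_inj k r r' s : embat k r s -> embat k r' s -> len r = len r' -> r = r'.
Proof.
case: r r' => n r [n' r'] [_ rs] [_ rs'] [E]; move: E rs rs' => /= E.
subst n'; rewrite /len /= => rs rs'; congr Tagged; apply/val_inj/setP => -[x y].
have := rs x y (ltn_ord x) (ltn_ord y); rewrite -rs' ?ltn_ord // !labE /=.
by rewrite !inord_val.
Qed.

Lemma embat_sub k l t : 0 < l -> k + l <= len t ->
  exists s, len s = l /\ embat k s t.
Proof.
case: l => // l _ kl; exists (ker l (fun i => lab t (k + i))); split=> //.
by split=> // i j il jl; rewrite lab_ker.
Qed.

Lemma embat_full s t : embat 0 s t -> len s = len t -> s = t.
Proof. by move=> st; apply: (embat_inj st). Qed.

(** * Relations over walks of the factor graph *)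

Section Avoidance.
Variable B : {fset eqvrel}.
(** Consecutive windows overlap in c points; their length [c.+1] is b as soon as b > 0. *)
Local Notation c := (maxlen B).-1.
Implicit Types (v w : vertex B) (p q : seq (vertex B)) (s t z : eqvrel).

Lemma AvP s :
  reflect (forall r k, r \in B -> ~ embat k r s) (s \in Av B).
Proof.
apply: (iffP allP) => [avs r k rB rs | avs r rB].
  by move/negP: (avs r rB); apply; apply/embP; exists k.
by apply/negP => /embP[k]; apply: avs.
Qed.

Lemma len_basis r : r \in B -> len r <= c.+1.
Proof.
by move=> rB; apply: leq_trans (leqSpred _); apply: leq_bigmax_seq.
Qed.

Lemma Av_embat k s t : embat k s t -> t \in Av B -> s \in Av B.
Proof.
move=> st /AvP avt; apply/AvP => r l rB rs.
exact: (avt r _ rB (embat_trans rs st)).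
Qed.

(* A forbidden relation has length at most c + 1, so no occurrence of it can
   straddle an overlap of length c. *)
Lemma Av_overlap d s t z : embat 0 s z -> embat d t z ->
  len s = d + c -> len z = d + len t -> s \in Av B -> t \in Av B -> z \in Av B.
Proof.
move=> sz tz ls lz /AvP avs /AvP avt; apply/AvP => r k rB rz.
have lr := len_basis rB; have [kz _] := rz.
have [ks|sk] := leqP (k + len r) (len s).
  by apply: (avs r k rB); apply: (@embat_inner k 0 r s z).
have kd : k = d + (k - d) by lia.
apply: (avt r (k - d) rB); apply: (@embat_inner (k - d) d r t z) => //; last lia.
by rewrite -kd.
Qed.

(** * Walks carried by relations, and amalgamation along edges *)

Definition vrel v : eqvrel := EqRel (val v).

Lemma len_vrel v : len (vrel v) = c.+1. Proof. by []. Qed.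

Lemma vrel_Av v : vrel v \in Av B. Proof. exact: (valP v). Qed.

Lemma vrel_inj : injective vrel.
Proof. by move=> v w E; apply: val_inj; apply: eq_from_Tagged E. Qed.

Fixpoint trace k p s : Prop :=
  if p is v :: p' then embat k (vrel v) s /\ trace k.+1 p' s else True.

(** For non-empty p and b > 0 this makes p the path Pi(s), as [Pi_walk] shows: s has [len s - c]
    windows of length c + 1. *)
Definition walk p s : Prop := size p + c = len s /\ trace 0 p s.

Lemma trace_cat k p q s : trace k (p ++ q) s <-> trace k p s /\ trace (k + size p) q s.
Proof.
elim: p k => [|v p IH] k /=; first by rewrite addn0; tauto.
rewrite IH addSnnS; tauto.
Qed.

Lemma trace_embat k d p s t : embat d s t -> trace k p s -> trace (d + k) p t.
Proof.
move=> st; elim: p k => [|v p IH] k //= [vs ps]; split; first exact: embat_trans st.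
by rewrite -addnS; apply: IH.
Qed.

Lemma trace_inner k d p s t : embat d s t -> k + size p + c <= len s ->
  trace (d + k) p t -> trace k p s.
Proof.
move=> st; elim: p k => [|v p IH] k //= ks [vt pt]; split.
  by apply: (embat_inner vt st); rewrite len_vrel; lia.
by apply: IH; [lia | rewrite addnS].
Qed.

Lemma trace_inj k p q s : size p = size q -> trace k p s -> trace k q s -> p = q.
Proof.
elim: p q k => [|v p IH] [|w q] k //= [szpq] [vs ps] [ws qs].
by rewrite (vrel_inj (embat_inj vs ws erefl)) (IH q k.+1).
Qed.

Lemma edgeP v w : reflect (forall i j, i < c -> j < c ->
    (lab (vrel v) i.+1 == lab (vrel v) j.+1) = (lab (vrel w) i == lab (vrel w) j))
  (edge v w).
Proof.
apply: (iffP eqP) => [E i j ic jc|E].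
  rewrite !labE /=; have /setP/(_ (Ordinal ic, Ordinal jc)) := congr1 (@pairs _) E.
  by rewrite !inE.
apply/val_inj/setP => -[i j]; rewrite !inE /=.
by have := E i j (ltn_ord i) (ltn_ord j); rewrite !labE.
Qed.

Lemma trace_edge k v w s : embat k (vrel v) s -> embat k.+1 (vrel w) s -> edge v w.
Proof.
move=> [_ vs] [_ ws]; apply/edgeP => i j ic jc.
by rewrite vs ?len_vrel // ws ?len_vrel ?addSnnS //; lia.
Qed.

Lemma trace_sorted k p s : trace k p s -> sorted (@edge B) p.
Proof.
elim: p k => [|v [|w p] IH] k //= [vs [ws ps]].
by rewrite (trace_edge vs ws) /=; apply: (IH k.+1).
Qed.

Lemma walk_exists s : s \in Av B -> c < len s ->
  exists p, [/\ walk p s, 0 < size p & sorted (@edge B) p].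
Proof.
move=> avs cs.
have window k : k + c < len s -> exists v, embat k (vrel v) s.
  move=> kc; have [[n r] [[En] rs]] : exists r, len r = c.+1 /\ embat k r s.
    by apply: embat_sub => //; lia.
  rewrite /= in En; subst n.
  by exists (exist _ r (Av_embat rs avs)).
have traces n k : k + n + c <= len s -> exists p, size p = n /\ trace k p s.
  elim: n k => [|n IH] k kn; first by exists [::].
  have [|v vs] := window k; first lia.
  have [|p [sp ps]] := IH k.+1; first lia.
  by exists (v :: p); rewrite /= sp.
have [|p [sp ps]] := traces (len s - c) 0; first lia.
exists p; split; [by split=> //; lia | by lia | exact: trace_sorted ps].
Qed.

(* Classes of s keep their label; a point of t outside the overlap takes the
   label of the points of the overlap in its class if there are any. *)
Lemma amalgam d s t m : len s = d + m -> m <= len t ->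
  (forall i j, i < m -> j < m ->
     (lab s (d + i) == lab s (d + j)) = (lab t i == lab t j)) ->
  exists z, [/\ len z = d + len t, embat 0 s z & embat d t z].
Proof.
move=> ls mt agree.
pose hit j := has (fun u => lab t u == lab t j) (iota 0 m).
(* Labels of s are below [len s], so the labels from [len s] on are fresh and keep apart the classes
   of t that miss the overlap. *)
pose f i := if i < len s then lab s i else
  if hit (i - d) then lab s (d + find (fun u => lab t u == lab t (i - d)) (iota 0 m))
  else len s + lab t (i - d).
have hitP j : hit j -> exists u, [/\ u < m, lab t u = lab t j & f (d + j) = lab s (d + u)].
  move=> hj; have jm : j < m \/ m <= j by lia.
  have fm : find (fun u => lab t u == lab t j) (iota 0 m) < m.
    by rewrite -[X in _ < X](size_iota 0) -has_find.
  case: jm => jm; first by exists j; rewrite /f ls ltn_add2l jm.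
  exists (find (fun u => lab t u == lab t j) (iota 0 m)); split=> //.
    by have := nth_find 0 hj; rewrite nth_iota // => /eqP.
  by rewrite /f ls ltn_add2l ltnNge jm /= addKn hj.
have missP j : ~~ hit j -> f (d + j) = len s + lab t j /\
    forall u, u < m -> (lab t u == lab t j) = false.
  move=> hj; have miss u : u < m -> (lab t u == lab t j) = false.
    move=> um; apply: contraNF hj => E.
    by apply/hasP; exists u; rewrite ?mem_iota.
  split=> //; rewrite /f; case: ltnP => [js|_]; last by rewrite addKn (negPf hj).
  have jm : j < m by lia.
  by have := miss j jm; rewrite eqxx.
have [z [lz zz]] : exists z, len z = d + len t /\
    forall i j, i < d + len t -> j < d + len t -> (lab z i == lab z j) = (f i == f j).
  have lt : 0 < len t by [].
  exists (ker (d + len t).-1 f); split=> [|i j id jd]; first by rewrite /len /=; lia.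
  by rewrite lab_ker //; lia.
exists z; split=> //; split; rewrite ?lz //; first by lia.
  move=> i j si sj; rewrite !add0n zz; try lia.
  by rewrite /f si sj.
move=> i j ti tj; rewrite zz ?ltn_add2l //.
have sep u x : (lab s u == len s + x) = false.
  by apply/eqP; have := lab_lt s u; lia.
have [hi|/missP[-> mi]] := boolP (hit i); have [hj|/missP[-> mj]] := boolP (hit j).
- have [u [um <- ->]] := hitP i hi; have [u' [um' <- ->]] := hitP j hj.
  by rewrite agree.
- by have [u [um <- ->]] := hitP i hi; rewrite sep mj.
- by have [u [um <- ->]] := hitP j hj; rewrite eq_sym (eq_sym (_ + _)) sep mi.
- by rewrite eqn_add2l.
Qed.

(** The edge says that the last c points of s and the first c points of t carry the same relation,
    as [amalgam] requires; [Av_overlap] keeps the result in Av(B). *)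
Lemma glue s t p q v w :
  s \in Av B -> t \in Av B -> walk (rcons p v) s -> walk (w :: q) t -> edge v w ->
  exists z, [/\ z \in Av B, walk (rcons p v ++ w :: q) z, embat 0 s z &
                embat (size p).+1 t z].
Proof.
move=> avs avt [ls ps] [lt qt] /edgeP vw; rewrite size_rcons in ls.
have [|||z [lz sz tz]] := @amalgam (size p).+1 s t c; rewrite -?ls -?lt //=.
- by lia.
- move=> i j ic jc; move: ps qt; rewrite -cats1 trace_cat /= => -[_ [[_ vs] _]] [[_ wt] _].
  rewrite -[i in RHS]add0n -[j in RHS]add0n -wt ?len_vrel; try lia.
  by rewrite -vw // vs ?len_vrel ?addSnnS //; lia.
exists z; split=> //.
  by apply: (Av_overlap sz tz); rewrite // -?ls -?lt //=; lia.
split; first by rewrite size_cat size_rcons lz -lt /=; lia.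
apply/trace_cat; split; first exact: (trace_embat sz ps).
by rewrite size_rcons add0n; have := trace_embat tz qt; rewrite addn0.
Qed.

Lemma walk_lift p : 0 < size p -> sorted (@edge B) p ->
  exists s, s \in Av B /\ walk p s.
Proof.
elim: p => [|v [|w p] IH] // _.
  by exists (vrel v); split; [apply: vrel_Av | split=> //; rewrite len_vrel add1n].
case/andP=> vw ep; have [//|//|t [avt pt]] := IH.
have [|z [avz pz _ _]] := @glue (vrel v) t [::] p v w (vrel_Av v) avt _ pt vw.
  by split=> //; rewrite len_vrel add1n.
by exists z.
Qed.

Lemma walk_extend a p q s : 0 < size p -> s \in Av B -> walk p s ->
  sorted (@edge B) (a ++ p ++ q) ->
  exists z, [/\ z \in Av B, walk (a ++ p ++ q) z & embat (size a) s z].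
Proof.
case/lastP: p => // p v _ avs ps epq.
have [z [avz pz sz]] : exists z,
    [/\ z \in Av B, walk (rcons p v ++ q) z & embat 0 s z].
  case: q epq => [|w q] epq; first by exists s; rewrite cats0.
  have /andP[vw eq] : edge v w && path (@edge B) w q.
    by move/cat_sorted2: epq => -[_]; rewrite cat_rcons sorted_cat_cons => /andP[].
  have [//|//|t [avt qt]] := @walk_lift (w :: q).
  by have [z [avz pz sz _]] := glue avs avt ps qt vw; exists z.
case: (rcons p v ++ q) pz epq (size_cat (rcons p v) q) => [|w r] pz epq.
  by rewrite size_rcons.
move=> _; case/lastP: a epq => [|a u] epq; first by exists z.
have [ea uw] : sorted (@edge B) (rcons a u) /\ edge u w.
  by move: epq; rewrite cat_rcons sorted_cat_cons => /andP[-> /andP[]].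
have [||t [avt at_]] := @walk_lift (rcons a u); rewrite ?size_rcons //.
have [y [avy py _ zy]] := glue avt avz at_ pz uw.
exists y; split=> //; rewrite -[_.+1]addn0; exact: embat_trans sz zy.
Qed.

Lemma walk_restrict a p q z : 0 < size p -> z \in Av B -> walk (a ++ p ++ q) z ->
  exists s, [/\ s \in Av B, walk p s & embat (size a) s z].
Proof.
move=> p0 avz [lz pz].
have [||s [ls sz]] := @embat_sub (size a) (size p + c) z.
- by lia.
- by rewrite -lz !size_cat; lia.
exists s; split=> //; first exact: Av_embat sz avz.
split=> //; apply: (trace_inner sz); first by lia.
by rewrite addn0; move: pz; rewrite !trace_cat add0n; tauto.
Qed.

(** * Ambiguity and uniqueness of the relation over a walk *)

Lemma specialP w : reflect
  (forall j, j < c -> (lab (vrel w) j == lab (vrel w) c) = false) (special w).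
Proof.
have rmax : inord c = ord_max :> 'I_c.+1 by apply: val_inj; rewrite /= inordK.
have hmax : ord_max \in eclass (val w) ord_max by rewrite inE erel_refl.
apply: (iffP cards1P) => [[x E] j jc|alone].
  apply/negP; rewrite eq_sym labE /= rmax => jw.
  have : (inord j : 'I_c.+1) \in eclass (val w) ord_max by rewrite inE.
  move: hmax; rewrite E !inE => /eqP<- /eqP/(congr1 val) /=.
  by rewrite inordK; lia.
exists ord_max; apply/setP => j; rewrite !inE.
apply/idP/eqP => [jw|->]; last exact: erel_refl.
apply: val_inj; have := ltn_ord j; rewrite ltnS leq_eqVlt => /predU1P[//|jc].
by have := alone j jc; rewrite eq_sym labE /= rmax inord_val jw.
Qed.

Lemma inactiveP s : reflect
  (exists2 x, x < len s &
     forall y, len s - c <= y < len s -> (lab s x == lab s y) = false)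
  (has_inactive_class B s).
Proof.
apply: (iffP existsP) => [[x /forallP xi]|[x xs xi]].
  exists x => // y /andP[cy ys]; apply/negP; rewrite labE inord_val => xy.
  have /implyP := xi (inord y : 'I_(tag s).+1).
  by rewrite inE xy inordK // => /(_ isT); lia.
exists (Ordinal xs); apply/forallP => y; apply/implyP; rewrite inE => xy.
rewrite ltnNge; apply/negP => cy; have := xi y; rewrite cy ltn_ord => /(_ isT).
by rewrite labE inord_val [inord x](inord_val (Ordinal xs)) /= => /negP; apply.
Qed.

Lemma Pi_walk p s : 0 < maxlen B -> 0 < size p -> walk p s -> Pi B s = map val p.
Proof.
move=> b0 p0 [lp ps]; have szE : (len s - maxlen B).+1 = size p by lia.
rewrite /Pi szE; have : 0 + size p + c <= len s by lia.
elim: p 0 ps {p0 lp szE} => [|v p IH] k //= [[kv vs] ps] kp.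
congr (_ :: _); last by apply: IH => //; lia.
apply/val_inj/setP => -[x y]; rewrite inE /= -labE -vs ?ltn_ord //.
by rewrite labE !inord_val.
Qed.

(* Appending a special vertex: the new entry gets label x, which is either fresh or
   the label of an inactive class. *)
Lemma add_special p v w s x : s \in Av B -> walk (rcons p v) s -> edge v w ->
  special w -> (forall j, len s - c <= j < len s -> (x == lab s j) = false) ->
  let z := ker (len s) (fun i => if i < len s then lab s i else x) in
  z \in Av B /\ walk (rcons (rcons p v) w) z.
Proof.
move=> avs [ls ps] /edgeP vw /specialP w1 xs z; rewrite size_rcons in ls.
have lz : len z = (len s).+1 by [].
have sz : embat 0 s z.
  split=> [|i j si sj]; first by rewrite lz; lia.
  by rewrite lab_ker ?add0n ?si ?sj //; lia.
have wz : embat (size p).+1 (vrel w) z.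
  split=> [|i j]; rewrite len_vrel; first by rewrite lz; lia.
  rewrite !ltnS => ic jc; rewrite lab_ker; try lia.
  have old k : k < c -> (size p).+1 + k < len s by lia.
  have sep k : k < c -> (lab s ((size p).+1 + k) == x) = false.
    by move=> kc; rewrite eq_sym xs //; lia.
  have new : ((size p).+1 + c < len s) = false by lia.
  move: ic jc; rewrite leq_eqVlt => /predU1P[->|ic];
    rewrite leq_eqVlt => /predU1P[->|jc]; rewrite ?new ?old ?eqxx //.
  - by rewrite eq_sym w1 // eq_sym sep.
  - by rewrite w1 // sep.
  move: ps; rewrite -cats1 trace_cat /= => -[_ [[_ vs] _]].
  by rewrite -vw // vs ?len_vrel ?addSnnS //; lia.
split; first by apply: (Av_overlap sz wz) (vrel_Av w) => //; rewrite ?lz ?len_vrel; lia.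
split; first by rewrite !size_rcons lz; lia.
rewrite -[rcons _ w]cats1; apply/trace_cat; split; first exact: (trace_embat sz ps).
by rewrite size_rcons.
Qed.

(** The entry added by the special vertex may join the inactive class or form a class of its own;
    every window of length c + 1 looks the same in both cases. *)
Lemma ambiguous_walk w : 0 < maxlen B -> ambiguous w ->
  exists p s t, [/\ 0 < size p, s \in Av B, t \in Av B & walk p s /\ walk p t /\ s <> t].
Proof.
move=> b0 [w1 [v vw [s [avs bs /inactiveP[x xs xi] [q qE]]]]].
have [|p [ps p0 _]] := walk_exists avs; first by lia.
have pE := Pi_walk b0 p0 ps; case/lastP: p p0 ps pE => // p v' _ ps.
rewrite qE map_rcons => /rcons_inj[_ /val_inj vE]; rewrite -{v'}vE in ps.
have [avj wj] := add_special avs ps vw w1 xi.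
(* [len s] exceeds all labels of s, so it makes the new entry a singleton class. *)
have [|avn wn] := @add_special p v w s (len s) avs ps vw w1.
  by move=> j _; apply/eqP; have := lab_lt s j; lia.
do 3!eexists; split; [|exact: avj|exact: avn|split; [exact: wj|split; [exact: wn|]]].
  by rewrite size_rcons.
move/(congr1 (fun z => lab z x == lab z (len s))).
rewrite !lab_ker ?xs ?ltnn ?eqxx //; try lia.
by move/esym/eqP; have := lab_lt s x; lia.
Qed.

(** By induction s and t agree apart from their last entry. How that entry relates to the earlier
    ones is forced by the last vertex, unless this vertex is special and some class is inactive,
    which is ambiguity. *)
Lemma walk_inj p s t : 0 < maxlen B -> (forall w, ~ ambiguous w) ->
  0 < size p -> s \in Av B -> t \in Av B -> walk p s -> walk p t -> s = t.
Proof.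
move=> b0 unamb; elim/last_ind: p s t => // p w IH s t _ avs avt ws wt.
have lst : len s = len t by case: ws wt => <- _ [<-].
case/lastP: p IH ws wt => [|p v] IH ws wt.
  case: ws wt => [ls [s0 _]] [lt [t0 _]].
  by rewrite size_rcons in ls lt; rewrite -(embat_full s0 ls) -(embat_full t0 lt).
have split_walk z : z \in Av B -> walk (rcons (rcons p v) w) z ->
    exists z', [/\ z' \in Av B, walk (rcons p v) z', embat 0 z' z,
                 embat (size p).+1 (vrel w) z & (len z').+1 = len z].
  move=> avz wz; have [|||z' [avz' wz' z'z]] := @walk_restrict [::] (rcons p v) [:: w] z.
  - by rewrite size_rcons.
  - by [].
  - by rewrite /= cats1.
  exists z'; split=> //; last by case: wz wz' => <- _ [<- _]; rewrite !size_rcons.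
  case: wz => _; rewrite -[rcons _ w]cats1 => /trace_cat[_ [/=]].
  by rewrite size_rcons.
have [s' [avs' ws' s's wls ls']] := split_walk s avs ws.
have [t' [avt' wt' t't wlt lt']] := split_walk t avt wt.
have vw : edge v w.
  have [_ ps] := ws; move/trace_sorted: ps.
  by rewrite -!cats1 -catA sorted_cat_cons => /andP[_ /andP[]].
have st' : s' = t' by apply: IH => //; rewrite size_rcons.
rewrite -{t'}st' in avt' wt' t't lt'.
have ls'E : len s' = (size p).+1 + c by case: ws' => <- _; rewrite size_rcons.
pose d := (size p).+1.
(* Either the class of i meets the last c entries of s', or the new entry is related to one of
   these. In both cases s' and w together decide whether i is related to the new entry. *)
have attach i : i < len s' -> exists j, j < c /\
    ((lab s' i == lab s' (d + j)) || (lab (vrel w) j == lab (vrel w) c)).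
  move=> si; apply: contrapT => none.
  have w1 : special w.
    apply/specialP => j jc; apply/negP => jw; apply: none.
    by exists j; rewrite jw orbT.
  apply: (unamb w); split=> //; exists v => //; exists s'; split=> //.
  - by lia.
  - apply/inactiveP; exists i => // y /andP[dy ys]; apply/negP => iy; apply: none.
    by exists (y - d); split; [lia | rewrite subnKC ?iy //; lia].
  - by exists (map val p); rewrite (Pi_walk _ _ ws') ?size_rcons // map_rcons.
have sub z : embat 0 s' z -> forall i j, i < len s' -> j < len s' ->
    (lab z i == lab z j) = (lab s' i == lab s' j) by case=> _ sz i j si sj; rewrite sz.
have last z : embat d (vrel w) z -> forall j, j < c ->
    (lab z (d + j) == lab z (d + c)) = (lab (vrel w) j == lab (vrel w) c).
  by case=> _ wz j jc; rewrite wz ?len_vrel //; lia.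
have top i : i < len s' ->
    (lab s i == lab s (d + c)) = (lab t i == lab t (d + c)).
  move=> si; have [j [jc]] := attach i si; have js : d + j < len s' by lia.
  case/orP=> hit.
    have /eqP-> : lab s i == lab s (d + j) by rewrite (sub s).
    have /eqP-> : lab t i == lab t (d + j) by rewrite (sub t).
    by rewrite !last.
  have /eqP<- : lab s (d + j) == lab s (d + c) by rewrite last.
  have /eqP<- : lab t (d + j) == lab t (d + c) by rewrite last.
  by rewrite (sub s) ?(sub t).
apply: embat_full => //; split=> [|i j si sj]; first by rewrite lst.
have edge_case k : k < len s -> k < len s' \/ k = d + c by lia.
rewrite !add0n; case: (edge_case i si) => [si'|->]; case: (edge_case j sj) => [sj'|->].
- by rewrite (sub s) ?(sub t).
- exact: top.
- by rewrite eq_sym top // eq_sym.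
- by rewrite !eqxx.
Qed.

(** * Joint embedding in Av(B) *)

(** The offset of an occurrence is also the position of its walk inside the larger one, so aligning
    walks aligns occurrences. *)
Lemma walk_infix k p r s z : walk p s -> embat k s z -> walk r z ->
  exists a d, r = a ++ p ++ d /\ size a = k.
Proof.
move=> [ls ps] sz [lz rz]; have [kz _] := sz.
have kr : size (take k r) = k by rewrite size_takel //; lia.
have pr : size (take (size p) (drop k r)) = size p.
  by rewrite size_takel // size_drop; lia.
exists (take k r), (drop (size p) (drop k r)); split=> //.
suff pE : p = take (size p) (drop k r).
  have rE : r = take k r ++ take (size p) (drop k r) ++ drop (size p) (drop k r).
    by rewrite !cat_take_drop.
  by rewrite {1}rE -pE.
apply: (@trace_inj k _ _ z); rewrite ?pr //.
  by have := trace_embat sz ps; rewrite addn0.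
move: rz; rewrite -[X in trace 0 X](cat_take_drop k) trace_cat kr add0n => -[_].
by rewrite -[X in trace k X](cat_take_drop (size p)) trace_cat => -[].
Qed.

Definition Av_jep : Prop := forall s t, s \in Av B -> t \in Av B ->
  exists z, [/\ z \in Av B, emb s z & emb t z].

Lemma emb_len s t : emb s t -> len s <= len t.
Proof. by case/embP=> k [kt _]; lia. Qed.

Lemma jep_walk_jep : Av_jep -> walk_jep (@edge B).
Proof.
move=> J p q p0 q0 ep eq.
have [s [avs ps]] := walk_lift p0 ep; have [t [avt qt]] := walk_lift q0 eq.
have [z [avz sz tz]] := J s t avs avt.
have cz : c < len z.
  apply: leq_trans (emb_len sz); case: ps => <- _.
  by rewrite -[X in X < _]add0n ltn_add2r.
have [r [rz _ er]] := walk_exists avz cz; exists r; split=> //.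
  case/embP: sz => k /(walk_infix ps)/(_ rz)[a [d [-> _]]]; exact: infix_infix.
case/embP: tz => k /(walk_infix qt)/(_ rz)[a [d [-> _]]]; exact: infix_infix.
Qed.

(* Extend the common walk of two relations through the bridge: as it is crossed only
   once, both occur at the same place of any joint extension. *)
Lemma jep_unambiguous v w : 0 < maxlen B -> Av_jep -> bridge (@edge B) v w ->
  forall u : vertex B, ~ ambiguous u.
Proof.
move=> b0 J br u /(ambiguous_walk b0)[p [s [t [p0 avs avt [ps [pt st]]]]]].
have ep : sorted (@edge B) p by case: ps => _; apply: trace_sorted.
have [a [d [er /infixP[l [q rE]]]]] := bridge_extend br ep p0.
rewrite rE in er.
have [y [avy ry sy]] := walk_extend p0 avs ps er.
have [z [avz rz tz]] := walk_extend p0 avt pt er.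
have [x [avx /embP[k yx] /embP[k' zx]]] := J y z avy avz.
have cx : c < len x.
  by have [kx _] := yx; case: ry => lr _; move: lr; rewrite !size_cat; lia.
have [f [fx _ ef]] := walk_exists avx cx.
have [m [n [fE mk]]] := walk_infix ry yx fx.
have [m' [n' [fE' mk']]] := walk_infix rz zx fx.
(* By [bridge_cut] the walk f crosses the bridge only once, so both copies of the extended walk
   start at the same position. *)
have kE : k = k'.
  rewrite -rE -!catA !cat_cons catA in fE; rewrite -rE -!catA !cat_cons catA in fE'.
  have [[E _ _ _]|wv|wv] := arc_order ef fE fE'; last 2 first.
  - by case/negP: (bridge_cut br).
  - by case/negP: (bridge_cut br).
  by move/(congr1 size): E; rewrite !size_cat mk mk' => /addIn.
case: st; rewrite -kE in zx.
have yz : y = z.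
  by apply: embat_inj yx zx _; case: ry rz => <- _ [<- _].
rewrite -yz in tz; apply: embat_inj sy tz _.
by case: ps pt => <- _ [<- _].
Qed.

Lemma embat_emb k s t : embat k s t -> emb s t.
Proof. by move=> st; apply/embP; exists k. Qed.

Lemma connected_jep s t : strongly_connected (@edge B) ->
  s \in Av B -> t \in Av B -> c < len s -> c < len t ->
  exists z, [/\ z \in Av B, emb s z & emb t z].
Proof.
move=> sc avs avt cs ct.
have [p [ps p0 ep]] := walk_exists avs cs.
have [q [qt q0 eq]] := walk_exists avt ct.
case/lastP: p ps p0 ep => // p v ps _ ep; case: q qt q0 eq => // w q qt _ eq.
(* Starting from a successor u of v gives a connecting walk of length at least one even when w = v.
   If v is a sink, strong connectivity leaves no other vertex, and t is the last window of s. *)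
have [/existsP[u vu]|/existsPn sink] := boolP [exists u, edge v u].
  have [r er rE] := connectP (sc u w).
  have ejoin : sorted (@edge B) ((rcons p v ++ belast u r) ++ w :: q).
    rewrite -catA -(cat_rcons w) rE -lastI cat_rcons sorted_cat_cons ep /=.
    by rewrite vu cat_path er -rE.
  have [e1 _] := cat_sorted2 ejoin.
  have [||y [avy ry sy]] := @walk_extend [::] (rcons p v) (belast u r) s _ avs ps.
  - by rewrite size_rcons.
  - exact: e1.
  rewrite cat0s in ry; move: (rcons p v ++ _) ejoin ry (size_cat (rcons p v) (belast u r)).
  case/lastP=> [|m x] ejoin ry; first by rewrite size_rcons.
  have xw : edge x w.
    by move: ejoin; rewrite cat_rcons sorted_cat_cons => /andP[_ /andP[]].
  have [z [avz _ yz tz]] := glue avy avt ry qt xw.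
  exists z; split=> //; last exact: embat_emb tz.
  exact: embat_emb (embat_trans sy yz).
have wv : w = v.
  have [[|x r] /= er ->] := connectP (sc v w); first by [].
  by move: (sink x); case/andP: er => ->.
have q0 : q = [::].
  by case: q eq {qt} => // x q /= /andP[wx _]; move: (sink x); rewrite -wv wx.
rewrite q0 wv in qt; case: qt => lt [vt _]; rewrite /= in lt.
have <- := embat_full vt lt.
exists s; split=> //; first exact: embat_emb (embat_refl s).
case: ps => _; rewrite -cats1 trace_cat /= => -[_ [vs _]]; exact: embat_emb vs.
Qed.

(** The relation s is extended over a walk containing the walks of both s and t; the piece of the
    extension over the walk of t is t itself by [walk_inj]. *)
Lemma bridge_Av_jep v w s t : 0 < maxlen B -> bridge (@edge B) v w ->
  (forall u : vertex B, ~ ambiguous u) ->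
  s \in Av B -> t \in Av B -> c < len s -> c < len t ->
  exists z, [/\ z \in Av B, emb s z & emb t z].
Proof.
move=> b0 br unamb avs avt cs ct.
have [p [ps p0 ep]] := walk_exists avs cs.
have [q [qt q0 eq]] := walk_exists avt ct.
have [r [er /infixP[a [d rE]] /infixP[a' [d' rE']]]] := bridge_jep br p0 q0 ep eq.
rewrite rE in er; have [z [avz rz sz]] := walk_extend p0 avs ps er.
exists z; split=> //; first exact: embat_emb sz.
rewrite -rE rE' in rz; have [t' [avt' qt' t'z]] := walk_restrict q0 avz rz.
by rewrite (walk_inj b0 unamb q0 avt avt' qt qt'); apply: embat_emb t'z.
Qed.

End Avoidance.

(** * Atomicity as joint embedding, and the characterization *)

(** If s and t have no joint extension, the elements of C not above s and those not above t cover C.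
    Conversely, a joint extension of some s outside D and some t outside E lies in neither. *)
Lemma atomic_jep (C : eqvrel -> Prop) : down_closed C ->
  (atomic C <-> forall s t, C s -> C t -> exists z, [/\ C z, emb s z & emb t z]).
Proof.
have refl s : emb s s by apply/embP; exists 0; apply: embat_refl.
have trans r s t : emb r s -> emb s t -> emb r t.
  by case/embP=> k rs /embP[l st]; apply/embP; exists (l + k); apply: embat_trans st.
move=> dC; split=> [atC s t Cs Ct|J [D [E [dD dE [DC nCD] [EC nCE] CE]]]].
  apply: contrapT => none; apply: atC.
  exists (fun z => C z /\ ~~ emb s z), (fun z => C z /\ ~~ emb t z).
  have down y : down_closed (fun z => C z /\ ~~ emb y z).
    move=> a b ab [Cb nb]; split; first exact: dC ab Cb.
    by apply: contra nb => ya; apply: trans ab.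
  have proper y : C y -> ((fun z => C z /\ ~~ emb y z) `<` C)%classic.
    by move=> Cy; split=> [z []|] // /(_ y Cy)[_]; rewrite refl.
  split; [exact: down | exact: down | exact: proper | exact: proper |].
  apply/seteqP; split=> [z Cz|z [[]|[]]] //.
  have [sz|nsz] := boolP (emb s z); last by left.
  right; split=> //; apply/negP => tz; apply: none; by exists z.
have [s [Cs nDs]] : exists s, C s /\ ~ D s.
  apply: contrapT => none; apply: nCD => s Cs.
  by apply: contrapT => nDs; apply: none; exists s.
have [t [Ct nEt]] : exists t, C t /\ ~ E t.
  apply: contrapT => none; apply: nCE => t Ct.
  by apply: contrapT => nEt; apply: none; exists t.
have [z [Cz sz tz]] := J s t Cs Ct.
by move: Cz; rewrite CE => -[/(dD _ _ sz)|/(dE _ _ tz)].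
Qed.

Theorem theorem10p6 (B : {fset eqvrel}) (b : nat) (B_neq0 : B != fset0)
    (b_def : b = maxlen B)
    (hC : (exists sigma, sigma \in Av B) ->
          exists2 rho, rho \in Av B & len rho = b) :
  atomic [set` Av B]%classic <->
  (forall sigma, sigma \in Av B -> 1 <= len sigma <= b - 1 ->
     exists rho, [/\ rho \in Av B, len rho = b & emb sigma rho]) /\
  (strongly_connected (@edge B) \/
   bicycle (@edge B) /\ forall nu : vertex B, ~ ambiguous nu).
Proof.
have b0 : 0 < maxlen B.
  have /fset0Pn[r rB] := B_neq0.
  by apply: leq_trans (leq_bigmax_seq r rB isT).
have dC : down_closed [set` Av B]%classic.
  by move=> s t /embP[k st]; apply: Av_embat st.
rewrite (atomic_jep dC); split=> [J|[short graph]].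
  split=> [s avs /andP[_ sb]|].
    (* Joint embedding with a relation of length b makes z at least that long. *)
    have [r avr rb] := hC (ex_intro _ s avs).
    have [z [avz /embP[k sz] /emb_len rz]] := J s r avs avr.
    (* The window of length b at l contains the copy of s: it starts where s does, unless it would
       run past the end of z, and then it is the last window. *)
    have [kz _] := sz; pose l := minn k (len z - b).
    have [||y [ly yz]] := @embat_sub l b z; [lia | by rewrite /l; lia |].
    exists y; split=> //; first exact: Av_embat yz avz.
    apply/embP; exists (k - l); apply: embat_inner yz _.
      by rewrite subnKC // /l; lia.
    by rewrite ly /l; lia.
  have [sc|nsc] := pselect (strongly_connected (@edge B)); [by left | right].
  have wJ : walk_jep (@edge B) by apply: jep_walk_jep.
  have [v [w [vw cut]]] := cut_edge_exists wJ nsc.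
  have br := cut_edge_bridge wJ vw cut.
  by split; [apply: bridge_bicycle br | apply: jep_unambiguous b0 _ br].
(* Condition (i) reduces joint embedding to relations of length at least b, which have non-empty
   walks. *)
have long s : s \in Av B ->
    exists s', [/\ s' \in Av B, emb s s' & (maxlen B).-1 < len s'].
  move=> avs; have [sb|bs] := leqP (len s) (b - 1).
    by have [r [avr rb sr]] := short s avs sb; exists r; split=> //; lia.
  exists s; split=> //; last by lia.
  by apply/embP; exists 0; apply: embat_refl.
have trans r s t : emb r s -> emb s t -> emb r t.
  by case/embP=> k rs /embP[l st]; apply/embP; exists (l + k); apply: embat_trans st.
move=> s t avs avt.
have [s' [avs' ss' cs]] := long s avs; have [t' [avt' tt' ct]] := long t avt.
suff [z [avz sz tz]] : exists z, [/\ z \in Av B, emb s' z & emb t' z].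
  by exists z; split; [| apply: trans sz | apply: trans tz].
have [sc|[bi unamb]] := graph; first exact: connected_jep.
(* A bicycle can itself be strongly connected, for instance when it is a single cycle. *)
have [sc|[v [w br]]] := bicycle_bridge bi; first exact: connected_jep.
exact: bridge_Av_jep br unamb _ _ _ _.
Qed.
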